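(* Let $G$ be a connected graph of order $n$ with minimum degree $\delta\ge 2$. Then \[ \frac{\delta}{\sqrt{2\delta-2}}\,ABC(G)\le AG(G)\le \frac{n-1}{\sqrt{2n-4}}\,ABC(G). \] Moreover, equality holds in the left-hand inequality if and only if $G$ is a $\delta$-regular graph, and equality holds in the right-hand inequality if and only if $G$ is isomorphic to $K_n$.
   Context: All graphs are finite, simple and undirected. $d_i$ is the degree of vertex $v_i$; $i\sim j$ denotes an edge $v_iv_j$ and sums over $i\sim j$ run over edges, each once. $AG(G)=\sum_{i\sim j}\frac12\left(\sqrt{d_i/d_j}+\sqrt{d_j/d_i}\right)$ and the atom-bond connectivity index is $ABC(G)=\sum_{i\sim j}\sqrt{\frac{d_i+d_j-2}{d_id_j}}$. *)

(* Defs.v *)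
From mathcomp Require Import all_boot all_order all_algebra.

Set Implicit Arguments.
Unset Strict Implicit.
Unset Printing Implicit Defensive.

Import GRing.Theory Num.Theory.
Local Open Scope ring_scope.

Record sgraph := SGraph {
  vertex :> finType;
  adj : rel vertex;
  adj_sym : symmetric adj;
  adj_irrefl : irreflexive adj
}.

Definition deg (G : sgraph) (x : G) : nat := #|[set y | adj x y]|.

(* Every degree is less than #|G|, so the default value of the minimum is
   reached only when G has no vertices (and is then 0). *)
Definition min_degree (G : sgraph) : nat :=
  (\big[minn/#|G|]_(x : G) deg x)%N.

Definition connected_graph (G : sgraph) : Prop :=
  (0 < #|G|)%N /\ forall x y : G, connect (@adj G) x y.

Definition regular_graph (G : sgraph) (k : nat) : Prop :=
  forall x : G, deg x = k.

Definition graph_iso (G H : sgraph) : Prop :=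
  exists2 f : G -> H, bijective f & {mono f : x y / adj x y}.

Lemma complete_sym n : symmetric (fun i j : 'I_n => i != j).
Proof. by move=> i j; rewrite eq_sym. Qed.

Lemma complete_irrefl n : irreflexive (fun i j : 'I_n => i != j).
Proof. by move=> i; rewrite eqxx. Qed.

Definition complete_graph (n : nat) : sgraph :=
  SGraph (@complete_sym n) (@complete_irrefl n).

(* Each edge xy is counted once, with its ends in increasing order for the
   enumeration of the vertices; f is meant to be symmetric in x and y. *)
Definition edge_sum (R : rcfType) (G : sgraph) (f : G -> G -> R) : R :=
  \sum_(x : G) \sum_(y : G | adj x y && (enum_rank x < enum_rank y)%N) f x y.

Definition AG (R : rcfType) (G : sgraph) : R :=
  edge_sum (fun x y : G =>
    2^-1 * (Num.sqrt ((deg x)%:R / (deg y)%:R)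
            + Num.sqrt ((deg y)%:R / (deg x)%:R))).

Definition ABC (R : rcfType) (G : sgraph) : R :=
  edge_sum (fun x y : G =>
    Num.sqrt (((deg x)%:R + (deg y)%:R - 2) / ((deg x)%:R * (deg y)%:R))).

(* Main.v *)
(** On an edge whose ends have degrees a and b, the term of AG divided by the
    term of ABC is h ((a + b) / 2) with h x = x / sqrt (2 x - 2).  The function
    h is strictly increasing on [2, +oo[, and the mean degree (a + b) / 2 of
    an edge lies between delta and n - 1, with equality only if both ends have
    the extremal degree.  The inequalities and their equality cases follow by
    summing over the edges, since every vertex lies on an edge. *)
Require Import Defs.
From mathcomp Require Import all_boot all_order all_algebra.
From mathcomp Require Import zify ring lra.

Set Implicit Arguments.
Unset Strict Implicit.
Unset Printing Implicit Defensive.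

Import Order.POrderTheory GRing.Theory Num.Theory.
Local Open Scope ring_scope.

Section EdgeTerms.
Variable R : rcfType.
Implicit Types a b x y : R.

Definition AG_term a b := 2^-1 * (Num.sqrt (a / b) + Num.sqrt (b / a)).
Definition ABC_term a b := Num.sqrt ((a + b - 2) / (a * b)).
Definition AG_ABC_ratio x := x / Num.sqrt (2 * x - 2).

(** Cross-multiplying and squaring leaves a difference that factors as
    [2 * ((y - x) * ((x - 1) * (y - 1) - 1))]. The last factor is positive because [x - 1] is at
    least 1 and [y - 1] exceeds 1. *)
Lemma AG_ABC_ratio_lt x y : 2 <= x -> x < y -> AG_ABC_ratio x < AG_ABC_ratio y.
Proof.
move=> x2 xy; rewrite /AG_ABC_ratio.
have sx : 0 < Num.sqrt (2 * x - 2) by rewrite sqrtr_gt0; lra.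
have sy : 0 < Num.sqrt (2 * y - 2) by rewrite sqrtr_gt0; lra.
rewrite ltr_pdivrMr // mulrAC ltr_pdivlMr //.
rewrite -(@ltr_pXn2r _ 2) ?nnegrE ?mulr_ge0 ?(ltW sx) ?(ltW sy) //; try lra.
rewrite !exprMn !sqr_sqrtr; try lra.
rewrite -subr_gt0.
have -> : y ^+ 2 * (2 * x - 2) - x ^+ 2 * (2 * y - 2) =
          2 * ((y - x) * ((x - 1) * (y - 1) - 1)) by ring.
rewrite pmulr_rgt0 // mulr_gt0 ?subr_gt0 //.
nra.
Qed.

Lemma AG_ABC_ratio_leif x y : 2 <= x -> x <= y ->
  AG_ABC_ratio x <= AG_ABC_ratio y ?= iff (x == y).
Proof.
move=> x2; rewrite le_eqVlt => /predU1P[->|xy].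
  by apply/leifP; rewrite !eqxx.
apply/leifP; rewrite lt_eqF //; exact: AG_ABC_ratio_lt.
Qed.

Lemma ABC_term_gt0 a b : 2 <= a -> 2 <= b -> 0 < ABC_term a b.
Proof.
by move=> a2 b2; rewrite sqrtr_gt0 divr_gt0 ?mulr_gt0 //; lra.
Qed.

(** Both sides equal [(a + b) / (2 * Num.sqrt (a * b))]: the root of [a + b - 2] cancels on the
    right. *)
Lemma AG_termE a b : 2 <= a -> 2 <= b ->
  AG_term a b = AG_ABC_ratio ((a + b) / 2) * ABC_term a b.
Proof.
move=> a2 b2; rewrite /AG_term /AG_ABC_ratio /ABC_term.
have -> : 2 * ((a + b) / 2) - 2 = a + b - 2 by field.
have s_neq0 : Num.sqrt (a + b - 2) != 0 by rewrite gt_eqF // sqrtr_gt0; lra.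
rewrite !sqrtrM ?sqrtrV ?mulr_ge0; try lra.
have sa : Num.sqrt a != 0 by rewrite gt_eqF // sqrtr_gt0; lra.
have sb : Num.sqrt b != 0 by rewrite gt_eqF // sqrtr_gt0; lra.
rewrite sqrtrM; last by lra.
(* With [a + b] written through the roots, the goal is a rational identity in the three square roots
   alone. *)
rewrite [X in _ = X / 2 / _ * _](_ : _ = Num.sqrt a ^+ 2 + Num.sqrt b ^+ 2).
  by field; rewrite sa sb s_neq0.
by rewrite !sqr_sqrtr //; lra.
Qed.

Lemma AG_term_lower_leif k a b : 2 <= k -> k <= a -> k <= b ->
  AG_ABC_ratio k * ABC_term a b <= AG_term a b ?= iff (a + b == 2 * k).
Proof.
move=> k2 ka kb; have w0 : 0 < ABC_term a b by apply: ABC_term_gt0; lra.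
have -> : (a + b == 2 * k) = (k == (a + b) / 2) by apply/eqP/eqP; lra.
rewrite AG_termE; try lra.
rewrite (mono_leif (ler_pM2r w0)).
by apply: AG_ABC_ratio_leif; lra.
Qed.

Lemma AG_term_upper_leif k a b : 2 <= a -> 2 <= b -> a <= k -> b <= k ->
  AG_term a b <= AG_ABC_ratio k * ABC_term a b ?= iff (a + b == 2 * k).
Proof.
move=> a2 b2 ak bk; have w0 : 0 < ABC_term a b by apply: ABC_term_gt0.
have -> : (a + b == 2 * k) = ((a + b) / 2 == k) by apply/eqP/eqP; lra.
rewrite AG_termE //.
rewrite (mono_leif (ler_pM2r w0)).
by apply: AG_ABC_ratio_leif; lra.
Qed.

End EdgeTerms.

Section Graph.
Variable G : sgraph.
Implicit Types x y : G.

Lemma min_degree_le x : (min_degree G <= deg x)%N.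
Proof.
rewrite /min_degree; have : x \in index_enum G by rewrite mem_index_enum.
elim: (index_enum G) => // z s IHs; rewrite inE big_cons => /predU1P[->|/IHs].
  exact: geq_minl.
exact/leq_trans/geq_minr.
Qed.

Lemma deg_le x : (deg x <= #|G|.-1)%N.
Proof.
rewrite -(cardsC1 x); apply/subset_leq_card/subsetP => y; rewrite !inE.
by apply: contraTneq => ->; rewrite adj_irrefl.
Qed.

(** The neighbourhood of [x] lies in the complement of [x], and equal cardinalities make the two
    sets coincide. *)
Lemma deg_eq_pred_card x : deg x = #|G|.-1 -> forall y, adj x y = (x != y).
Proof.
move=> dx y; have /eqP Nx : [set z | adj x z] == [set~ x].
  rewrite eqEcard cardsC1 -dx leqnn andbT; apply/subsetP => z; rewrite !inE.
  by apply: contraTneq => ->; rewrite adj_irrefl.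
by have /setP/(_ y) := Nx; rewrite !inE eq_sym.
Qed.

(** When every degree is [#|G|.-1], adjacency is distinctness, so any bijection with the ordinals is
    an isomorphism; [enum_rank] serves. *)
Lemma graph_iso_completeP :
  graph_iso G (complete_graph #|G|) <-> regular_graph G #|G|.-1.
Proof.
split=> [[f [g fK gK] fM] x|reg].
  rewrite /deg -(cardsC1 x); apply: eq_card => y; rewrite !inE -fM /=.
  by rewrite (can_eq fK) eq_sym.
exists (enum_rank : G -> complete_graph #|G|).
  by exists enum_val; [exact: enum_rankK | exact: enum_valK].
by move=> x y /=; rewrite (inj_eq enum_rank_inj) deg_eq_pred_card.
Qed.

Lemma edge_sumZ (R : rcfType) (c : R) (f : G -> G -> R) :
  c * edge_sum f = edge_sum (fun x y => c * f x y).
Proof. by rewrite mulr_sumr; apply: eq_bigr => x _; rewrite mulr_sumr. Qed.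

(** The sum sees one orientation of each edge, while the equality condition ranges over both; the
    symmetry of [C] bridges the two. *)
Lemma edge_sum_leif (R : rcfType) (f g : G -> G -> R) (C : rel G) :
  symmetric C ->
  (forall x y, adj x y -> f x y <= g x y ?= iff C x y) ->
  edge_sum f <= edge_sum g ?= iff [forall x, forall (y | adj x y), C x y].
Proof.
move=> Csym fg.
have -> : [forall x, forall (y | adj x y), C x y] =
  [forall x, forall (y | adj x y && (enum_rank x < enum_rank y)%N), C x y].
  apply/'forall_forall_inP/'forall_forall_inP => H x y.
    by case/andP=> xy _; apply: H.
  move=> xy; have [lt|gt|/val_inj/enum_rank_inj eq] :=
    ltngtP (enum_rank x) (enum_rank y).
  - by apply: H; rewrite xy.
  - by rewrite Csym; apply: H; rewrite adj_sym xy.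
  - by rewrite eq adj_irrefl in xy.
by apply: leif_sum => x _; apply: leif_sum => y /andP[xy _]; apply: fg.
Qed.

(** All degrees lie on the same side of [k], so a degree sum of [2 * k] forces both ends to have
    degree [k]. Positive degrees put every vertex on an edge. *)
Lemma edge_deg_sum_regular k : (forall x : G, 0 < deg x)%N ->
  (forall x : G, deg x <= k)%N \/ (forall x : G, k <= deg x)%N ->
  reflect (regular_graph G k)
    [forall x : G, forall (y | adj x y), (deg x + deg y == 2 * k)%N].
Proof.
move=> deg_gt0 bnd; apply: (iffP 'forall_forall_inP) => [H x|reg x y _].
  have /card_gt0P[y] := deg_gt0 x; rewrite inE => /H /eqP.
  by case: bnd => bnd; have := (bnd x, bnd y) => -[]; lia.
by rewrite !reg; lia.
Qed.

End Graph.

Theorem theorem9 (R : rcfType) (G : sgraph) (n delta : nat)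
    (Gconn : connected_graph G)
    (Gorder : #|G| = n)
    (Gmin : min_degree G = delta)
    (delta_ge2 : (2 <= delta)%N) :
  [/\ delta%:R / Num.sqrt (2 * delta%:R - 2) * ABC R G <= AG R G,
      AG R G <= (n%:R - 1) / Num.sqrt (2 * n%:R - 4) * ABC R G,
      delta%:R / Num.sqrt (2 * delta%:R - 2) * ABC R G = AG R G
        <-> regular_graph G delta
    & AG R G = (n%:R - 1) / Num.sqrt (2 * n%:R - 4) * ABC R G
        <-> graph_iso G (complete_graph n)].
Proof.
have dmin (x : G) : (delta <= deg x)%N by rewrite -Gmin min_degree_le.
have dge2 (x : G) : (2 <= deg x)%N := leq_trans delta_ge2 (dmin x).
have dmax (x : G) : (deg x <= n.-1)%N by rewrite -Gorder deg_le.
have dgt0 (x : G) : (0 < deg x)%N := ltnW (dge2 x).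
have n_gt0 : (0 < n)%N by rewrite -Gorder; case: Gconn.
have Csym k : symmetric (fun x y : G => (deg x + deg y == 2 * k)%N).
  by move=> x y; rewrite addnC.
have natE k (x y : G) : (deg x + deg y == 2 * k)%N =
    ((deg x)%:R + (deg y)%:R == 2 * k%:R :> R).
  by rewrite -natrD -natrM eqr_nat.
have lower : AG_ABC_ratio delta%:R * ABC R G <= AG R G
    ?= iff [forall x : G, forall (y | adj x y), (deg x + deg y == 2 * delta)%N].
  rewrite edge_sumZ; apply: edge_sum_leif => // x y _; rewrite natE.
  by apply: AG_term_lower_leif; rewrite ler_nat.
have upper : AG R G <= AG_ABC_ratio n.-1%:R * ABC R G
    ?= iff [forall x : G, forall (y | adj x y), (deg x + deg y == 2 * n.-1)%N].
  rewrite edge_sumZ; apply: edge_sum_leif => // x y _; rewrite natE.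
  by apply: AG_term_upper_leif; rewrite ler_nat.
(* With [n] positive, [n.-1] casts to [n%:R - 1], and [2 * (n%:R - 1) - 2] is [2 * n%:R - 4]. *)
have nE : (n%:R - 1) / Num.sqrt (2 * n%:R - 4) = AG_ABC_ratio n.-1%:R :> R.
  rewrite /AG_ABC_ratio -subn1 natrB //; congr (_ / Num.sqrt _); ring.
rewrite nE -[_ / _]/(AG_ABC_ratio delta%:R); split.
- exact: lower.
- exact: upper.
- rewrite (rwP eqP) (eq_leif lower); apply: iff_sym.
  exact: (rwP (edge_deg_sum_regular dgt0 (or_intror dmin))).
(* Being complete is being regular of degree [n.-1], so the degree-sum criterion applies again, now
   with degrees bounded above. *)
- rewrite -Gorder graph_iso_completeP Gorder.
  rewrite (rwP eqP) (eq_leif upper); apply: iff_sym.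
  exact: (rwP (edge_deg_sum_regular dgt0 (or_introl dmax))).
Qed.
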